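(* Let $\Gamma$ be a groupoid and let $R$ be a $\Gamma$-graded (not necessarily object unital) right gr-primitive ring. Let $S$ be a faithful gr-simple $\Gamma$-graded right $R$-module and let $D:=\mathrm{END}(S_R)$. Then $R$ is gr-isomorphic to a gr-dense subring of $\mathrm{END}({}_DS)$.
   Context: A groupoid $\Gamma$ is a small category with all morphisms invertible, identified with its set of morphisms; $\Gamma_0$ is its set of objects (identified with identity morphisms). For $\gamma:e\to f$ write $d(\gamma)=e$, $r(\gamma)=f$; $\delta\gamma$ is defined iff $d(\delta)=r(\gamma)$. In this statement, a $\Gamma$-graded ring is an associative ring $R=\bigoplus_{\gamma\in\Gamma}R_\gamma$ (additive subgroups) with $R_\gamma R_\delta\subseteq R_{\gamma\delta}$ if $\gamma\delta$ is defined and $R_\gamma R_\delta=0$ otherwise; no identity elements are assumed. A $\Gamma$-graded right $R$-module is a right $R$-module $M=\bigoplus_\gamma M_\gamma$ with $M_\gamma R_\delta\subseteq M_{\gamma\delta}$ if defined and $M_\gamma R_\delta=0$ otherwise; $MR=M$ is not assumed. $M$ is gr-simple if $MR\ne0$ and its only graded submodules are $\{0\}$ and $M$; it is faithful if $\{a\in R:Ma=0\}=\{0\}$. $R$ is right gr-primitive if there exists a faithful gr-simple $\Gamma$-graded right $R$-module. Graded rings are gr-isomorphic if there is a degree-preserving ring isomorphism between them. A graded subring of a $\Gamma$-graded ring $E$ is a subring $T$ (closed under addition, negatives and multiplication) with $T=\bigoplus_\gamma(T\cap E_\gamma)$. For a $\Gamma$-graded right module $M$, $\mathrm{END}(M_R)=\bigoplus_\gamma\mathrm{END}(M_R)_\gamma$,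 where $\mathrm{END}(M_R)_\gamma$ is the group of $R$-module endomorphisms $g$ with $g(M_\sigma)\subseteq M_{\gamma\sigma}$ for all $\sigma$ (with $M_{\gamma\sigma}=0$ if $\gamma\sigma$ is undefined); it is a $\Gamma$-graded ring under composition. With $S$ and $D$ as in the claim, $D$ is a $\Gamma$-graded division ring (each nonzero $a\in D_\gamma$ has $a^{-1}\in D_{\gamma^{-1}}$ with $aa^{-1}=1_{r(\gamma)}$ and $a^{-1}a=1_{d(\gamma)}$, where $1_e$ is the identity of $D_e$) and $S$ is a unital $\Gamma$-graded left $D$-module. For a $\Gamma$-graded left $D$-module $V$, homomorphisms are written on the right, $x\mapsto(x)g$, composed from left to right, and $\mathrm{END}({}_DV)=\mathrm{END}_D(V)=\bigoplus_\gamma\mathrm{END}_D(V)_\gamma$, where $\mathrm{END}_D(V)_\gamma$ consists of the $D$-linear $g$ with $(V_\sigma)g\subseteq V_{\sigma\gamma}$ for all $\sigma$ (with $V_{\sigma\gamma}=0$ if undefined). A sequence $(u_1,\dots,u_n)\in V_{\gamma_1}\times\cdots\times V_{\gamma_n}$ of (nonzero) homogeneous elements of a $\Gamma$-graded left $D$-module $V$ is pseudo-linearly independent if the only $(a_i)\in\bigoplus_iD1_{r(\gamma_i)}$ with $\sum a_iu_i=0$ is $(a_i)=0$. A graded subring $T$ of $\mathrm{END}_D(V)$ is gr-dense if for all $n>0$, all $\gamma_1,\dots,\gamma_n\in\Gamma$, every pseudo-linearly independent sequence $(u_1,\dots,u_n)\in V_{\gamma_1}\times\cdots\times V_{\gamma_n}$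 and every $(v_1,\dots,v_n)\in V_{\delta_1}\times\cdots\times V_{\delta_n}$ with $r(\delta_i)=r(\gamma_i)$ for all $i$, there exists $t\in T$ with $(u_i)t=v_i$ for all $i=1,\dots,n$. *)

(* Defs.v *)
From HB Require Import structures.
From mathcomp Require Import all_boot all_algebra.
From mathcomp Require Import boolp classical_sets functions.

Set Implicit Arguments.
Unset Strict Implicit.
Unset Printing Implicit Defensive.

Import GRing.Theory.
Local Open Scope classical_set_scope.
Local Open Scope ring_scope.

(* A groupoid is handled through its set of morphisms.  An object [e] is
   identified with the identity morphism [gid e].  [gcomp g h] stands for the
   product [g h] and is meaningful only when [gdom g = gcod h] (composition
   from right to left); its value on other pairs is never used. *)
Record groupoid := Groupoid {
  gmor :> Type;
  gobj : Type;
  gdom : gmor -> gobj;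
  gcod : gmor -> gobj;
  gid : gobj -> gmor;
  gcomp : gmor -> gmor -> gmor;
  ginv : gmor -> gmor;
  gdom_id : forall e, gdom (gid e) = e;
  gcod_id : forall e, gcod (gid e) = e;
  gdom_comp : forall g h, gdom g = gcod h -> gdom (gcomp g h) = gdom h;
  gcod_comp : forall g h, gdom g = gcod h -> gcod (gcomp g h) = gcod g;
  gcompA : forall g h k, gdom g = gcod h -> gdom h = gcod k ->
    gcomp g (gcomp h k) = gcomp (gcomp g h) k;
  gcomp1 : forall g, gcomp g (gid (gdom g)) = g;
  gcomp_id : forall g, gcomp (gid (gcod g)) g = g;
  gdom_inv : forall g, gdom (ginv g) = gcod g;
  gcod_inv : forall g, gcod (ginv g) = gdom g;
  gcompV : forall g, gcomp g (ginv g) = gid (gcod g);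
  gcompVg : forall g, gcomp (ginv g) g = gid (gdom g) }.

Definition is_subgroup (V : zmodType) (N : set V) : Prop :=
  N 0 /\ forall x y, N x -> N y -> N (x - y).

Definition sumset (I : Type) (V : zmodType) (W : I -> set V) : set V :=
  [set v | exists n (g : 'I_n -> I) (x : 'I_n -> V),
     (forall i, W (g i) (x i)) /\ v = \sum_i x i].

Definition independent (I : Type) (V : zmodType) (W : I -> set V) : Prop :=
  forall n (g : 'I_n -> I) (x : 'I_n -> V), injective g ->
    (forall i, W (g i) (x i)) -> \sum_i x i = 0 -> forall i, x i = 0.

Definition direct_sum (I : Type) (V : zmodType) (N : set V) (W : I -> set V) :=
  [/\ forall i, is_subgroup (W i), N = sumset W & independent W].

Lemma subgroupN (V : zmodType) (N : set V) x : is_subgroup N -> N x -> N (- x).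
Proof. by move=> [N0 NB] Nx; rewrite -(sub0r x); exact: NB. Qed.

Lemma subgroupD (V : zmodType) (N : set V) x y :
  is_subgroup N -> N x -> N y -> N (x + y).
Proof.
by move=> hN Nx Ny; rewrite -(opprK y); apply: (hN.2) => //; exact: subgroupN.
Qed.

Lemma subgroup_sum (V : zmodType) (N : set V) (J : Type) (r : seq J)
    (P : pred J) (F : J -> V) :
  is_subgroup N -> (forall j, P j -> N (F j)) -> N (\sum_(j <- r | P j) F j).
Proof.
move=> hN NF; apply: (big_ind N) => //; first exact: hN.1.
by move=> x y; exact: subgroupD.
Qed.

Lemma sumset_sub (I : Type) (V : zmodType) (W : I -> set V) i :
  W i `<=` sumset W.
Proof.
move=> x Wx; exists 1%N, (fun=> i), (fun=> x); split=> //.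
by rewrite big_ord1.
Qed.

Lemma sumset_subgroup (I : Type) (V : zmodType) (W : I -> set V) :
  (forall i, is_subgroup (W i)) -> is_subgroup (sumset W).
Proof.
move=> hW; split.
  have g : 'I_0 -> I by case.
  by exists 0%N, g, (fun=> 0); split; [case | rewrite big_ord0].
move=> _ _ [n [g [x [Wx ->]]]] [m [h [y [Wy ->]]]].
exists (n + m)%N, (fun i => match fintype.split i with inl j => g j | inr k => h k end),
  (fun i => match fintype.split i with inl j => x j | inr k => - y k end); split.
  by move=> i; case: (fintype.split i) => j //; exact: subgroupN.
rewrite big_split_ord /= -sumrN; congr (_ + _); apply: eq_bigr => i _.
  by rewrite (unsplitK (inl i : 'I_n + 'I_m)).
by rewrite (unsplitK (inr i : 'I_n + 'I_m)).
Qed.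

Lemma independent_filter (I : Type) (V : zmodType) (W : I -> set V)
    (A : I -> bool) n (g : 'I_n -> I) (x : 'I_n -> V) :
  (forall i, is_subgroup (W i)) -> independent W ->
  (forall i, W (g i) (x i)) -> \sum_i x i = 0 -> \sum_(i | A (g i)) x i = 0.
Proof.
move=> hW iW Wx x0.
pose g' : 'I_n -> {classic I} := g.
pose s : seq {classic I} := undup [seq g' i | i <- enum 'I_n].
have gs i : g' i \in s by rewrite mem_undup map_f// mem_enum.
case: (posnP n) => [n0|n_gt0].
  by apply: big1 => i _; have := leq_ltn_trans (leq0n i) (ltn_ord i); rewrite n0.
pose d : {classic I} := g' (Ordinal n_gt0).
pose h (j : 'I_(size s)) : {classic I} := nth d s j.
have h_inj : injective h.
  by move=> j k /eqP; rewrite nth_uniq ?undup_uniq// => /eqP /val_inj.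
pose w j := \sum_(i | g' i == h j) x i.
have part (F : 'I_n -> V) (P : pred 'I_n) :
    \sum_(i | P i) F i = \sum_j \sum_(i | P i && (g' i == h j)) F i.
  have lt i : (index (g' i) s < size s)%N by rewrite index_mem.
  rewrite (partition_big (fun i => Ordinal (lt i)) xpredT)//=.
  apply: eq_bigr => j _; apply: eq_bigl => i; congr andb.
  apply/eqP/eqP => [<-|e]; first by rewrite /h /= nth_index.
  by apply: val_inj; rewrite /= e index_uniq ?undup_uniq.
have w0 j : w j = 0.
  have Ww k : W (h k) (w k).
    by apply: subgroup_sum => // i /eqP <-; exact: Wx.
  by apply: (iW _ h _ h_inj Ww); rewrite -[RHS]x0; exact: esym (part x xpredT).
apply: (etrans (part x (fun i => A (g i)))); apply: big1 => j _.
case Aj : (A (h j)).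
  rewrite -[RHS](w0 j); apply: eq_bigl => i.
  by case: eqP; rewrite ?andbF ?andbT// => e; rewrite -[g i]/(g' i) e.
rewrite big1// => i /andP[Ai /eqP e].
by move: Ai; rewrite -[g i]/(g' i) e Aj.
Qed.

Record subgroup (V : zmodType) := Subgroup {
  sg_set : set V;
  sg_prop : is_subgroup sg_set }.

Definition sg_pred (V : zmodType) (H : subgroup V) : {pred V} :=
  fun x => x \in sg_set H.

Record sg_elt (V : zmodType) (H : subgroup V) := SgElt {
  sg_val : V;
  sg_mem : sg_val \in sg_pred H }.

Section SgElt.
Variables (V : zmodType) (H : subgroup V).

Fact sg_pred_closed : zmod_closed (sg_pred H).
Proof.
split; first by apply: mem_set; exact: (sg_prop H).1.
by move=> x y /set_mem Hx /set_mem Hy; apply: mem_set; exact: (sg_prop H).2.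
Qed.

HB.instance Definition _ := GRing.isZmodClosed.Build V (sg_pred H)
  sg_pred_closed.

HB.instance Definition _ := [isSub of sg_elt H for @sg_val V H].
HB.instance Definition _ := [Choice of sg_elt H by <:].
HB.instance Definition _ := [SubChoice_isSubZmodule of sg_elt H by <:].

Definition sg_in (x : V) (Hx : sg_set H x) : sg_elt H := SgElt (mem_set Hx).

Lemma sg_valP (x : sg_elt H) : sg_set H (sg_val x).
Proof. exact: set_mem (sg_mem x). Qed.

Lemma sg_val_inj : injective (@sg_val V H).
Proof. exact: val_inj. Qed.

Lemma sg_val0 : sg_val (0 : sg_elt H) = 0.
Proof. exact: (raddf0 (val : sg_elt H -> V)). Qed.

Lemma sg_valD (x y : sg_elt H) : sg_val (x + y) = sg_val x + sg_val y.
Proof. exact: (raddfD (val : sg_elt H -> V)). Qed.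

Lemma sg_valB (x y : sg_elt H) : sg_val (x - y) = sg_val x - sg_val y.
Proof. exact: (raddfB (val : sg_elt H -> V)). Qed.

Lemma sg_val_sum (J : Type) (r : seq J) (P : pred J) (F : J -> sg_elt H) :
  sg_val (\sum_(j <- r | P j) F j) = \sum_(j <- r | P j) sg_val (F j).
Proof. exact: (raddf_sum (val : sg_elt H -> V)). Qed.

Lemma sg_direct_sum (I : Type) (W : I -> set V) : direct_sum (sg_set H) W ->
  direct_sum setT (fun i => [set x : sg_elt H | W i (sg_val x)]).
Proof.
move=> [hW HE iW]; split.
- move=> i; split; first by rewrite /mkset sg_val0; exact: (hW i).1.
  by move=> x y Wx Wy; rewrite /mkset sg_valB; exact: (hW i).2.
- apply/seteqP; split=> // x _.
  have := sg_valP x; rewrite HE => -[n [g [y [Wy e]]]].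
  have Hy i : sg_set H (y i) by rewrite HE; exact: sumset_sub (Wy i).
  exists n, g, (fun i => sg_in (Hy i)); split=> //.
  by apply: sg_val_inj; rewrite sg_val_sum.
- move=> n g x g_inj Wx x0 i; apply: sg_val_inj; rewrite sg_val0.
  apply: (iW n g (fun i => sg_val (x i))) => //.
  by rewrite -sg_val_sum x0 sg_val0.
Qed.

End SgElt.

(* Associative rings without identity: only the underlying additive group is
   taken from the algebraic hierarchy. *)
Record gradedRing (G : groupoid) := GradedRing {
  gr_sort :> zmodType;
  gr_mul : gr_sort -> gr_sort -> gr_sort;
  gr_hom : G -> set gr_sort;
  gr_mulA : associative gr_mul;
  gr_mulDl : left_distributive gr_mul +%R;
  gr_mulDr : right_distributive gr_mul +%R;
  gr_direct : direct_sum setT gr_hom;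
  gr_hom_mul : forall g h x y, gr_hom g x -> gr_hom h y ->
    gdom g = gcod h -> gr_hom (gcomp g h) (gr_mul x y);
  gr_hom_mul0 : forall g h x y, gr_hom g x -> gr_hom h y ->
    gdom g <> gcod h -> gr_mul x y = 0 }.

Arguments gr_mul {G _} _ _.
Arguments gr_hom {G} _ _ _.

(* [our_one e] is the element written 1_e: by the last two axioms it is the
   identity of the component of degree [gid e], hence is determined by it. *)
Record objUnitalRing (G : groupoid) := ObjUnitalRing {
  our_ring :> gradedRing G;
  our_one : gobj G -> our_ring;
  our_one_hom : forall e, gr_hom our_ring (gid e) (our_one e);
  our_mul1 : forall g x, gr_hom our_ring g x ->
    gr_mul x (our_one (gdom g)) = x;
  our_1mul : forall g x, gr_hom our_ring g x ->
    gr_mul (our_one (gcod g)) x = x }.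

Arguments our_one {G} _ _.

Definition gr_isomorphic (G : groupoid) (R R' : gradedRing G) : Prop :=
  exists phi : R -> R',
    [/\ forall x y, phi (x + y) = phi x + phi y,
        forall x y, phi (gr_mul x y) = gr_mul (phi x) (phi y),
        bijective phi
      & forall g x, gr_hom R g x -> gr_hom R' g (phi x)].

Record gradedSubring (G : groupoid) (E : gradedRing G) := GradedSubring {
  gs_set : set E;
  gs_subgroup : is_subgroup gs_set;
  gs_mul : forall x y, gs_set x -> gs_set y -> gs_set (gr_mul x y);
  gs_direct : direct_sum gs_set (fun g => gs_set `&` gr_hom E g) }.

Section SubringRing.
Variables (G : groupoid) (E : gradedRing G) (T : gradedSubring E).

Definition subring_sg : subgroup E := Subgroup (gs_subgroup T).

Definition subring_mul (x y : sg_elt subring_sg) : sg_elt subring_sg :=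
  sg_in (gs_mul (sg_valP x) (sg_valP y) : sg_set subring_sg _).

Definition subring_hom (g : G) : set (sg_elt subring_sg) :=
  [set x | (gs_set T `&` gr_hom E g) (sg_val x)].

Fact subring_mulA : associative subring_mul.
Proof. by move=> x y z; apply: sg_val_inj; exact: gr_mulA. Qed.

Fact subring_mulDl : left_distributive subring_mul +%R.
Proof.
move=> x y z; apply: sg_val_inj.
rewrite sg_valD -[LHS]/(gr_mul (sg_val (x + y)) (sg_val z)) sg_valD.
exact: gr_mulDl.
Qed.

Fact subring_mulDr : right_distributive subring_mul +%R.
Proof.
move=> x y z; apply: sg_val_inj.
rewrite sg_valD -[LHS]/(gr_mul (sg_val x) (sg_val (y + z))) sg_valD.
exact: gr_mulDr.
Qed.

Fact subring_direct : direct_sum setT subring_hom.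
Proof. exact: (sg_direct_sum (H := subring_sg) (gs_direct T)). Qed.

Fact subring_hom_mul g h x y : subring_hom g x -> subring_hom h y ->
  gdom g = gcod h -> subring_hom (gcomp g h) (subring_mul x y).
Proof.
move=> [Tx hx] [Ty hy] e; split; first exact: gs_mul.
exact: gr_hom_mul.
Qed.

Fact subring_hom_mul0 g h x y : subring_hom g x -> subring_hom h y ->
  gdom g <> gcod h -> subring_mul x y = 0.
Proof.
move=> [Tx hx] [Ty hy] e; apply: sg_val_inj; rewrite sg_val0.
exact: gr_hom_mul0 hx hy e.
Qed.

Definition subring_gradedRing : gradedRing G :=
  GradedRing subring_mulA subring_mulDl subring_mulDr subring_direct
    subring_hom_mul subring_hom_mul0.

End SubringRing.

Record gradedRMod (G : groupoid) (R : gradedRing G) := GradedRMod {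
  rm_sort :> zmodType;
  rm_act : rm_sort -> R -> rm_sort;
  rm_hom : G -> set rm_sort;
  rm_actA : forall x a b, rm_act x (gr_mul a b) = rm_act (rm_act x a) b;
  rm_actDl : forall x y a, rm_act (x + y) a = rm_act x a + rm_act y a;
  rm_actDr : forall x a b, rm_act x (a + b) = rm_act x a + rm_act x b;
  rm_direct : direct_sum setT rm_hom;
  rm_hom_act : forall g h x a, rm_hom g x -> gr_hom R h a ->
    gdom g = gcod h -> rm_hom (gcomp g h) (rm_act x a);
  rm_hom_act0 : forall g h x a, rm_hom g x -> gr_hom R h a ->
    gdom g <> gcod h -> rm_act x a = 0 }.

Arguments rm_act {G R _} _ _.
Arguments rm_hom {G R} _ _ _.

Record gradedLMod (G : groupoid) (D : objUnitalRing G) := GradedLMod {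
  lm_sort :> zmodType;
  lm_act : D -> lm_sort -> lm_sort;
  lm_hom : G -> set lm_sort;
  lm_actA : forall a b x, lm_act (gr_mul a b) x = lm_act a (lm_act b x);
  lm_actDl : forall a b x, lm_act (a + b) x = lm_act a x + lm_act b x;
  lm_actDr : forall a x y, lm_act a (x + y) = lm_act a x + lm_act a y;
  lm_direct : direct_sum setT lm_hom;
  lm_hom_act : forall g h a x, gr_hom D g a -> lm_hom h x ->
    gdom g = gcod h -> lm_hom (gcomp g h) (lm_act a x);
  lm_hom_act0 : forall g h a x, gr_hom D g a -> lm_hom h x ->
    gdom g <> gcod h -> lm_act a x = 0;
  lm_act1 : forall g x, lm_hom g x -> lm_act (our_one D (gcod g)) x = x }.

Arguments lm_act {G D _} _ _.
Arguments lm_hom {G D} _ _ _.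

Section RModProperties.
Variables (G : groupoid) (R : gradedRing G) (M : gradedRMod R).

Definition graded_submodule (N : set M) : Prop :=
  [/\ is_subgroup N,
      forall x a, N x -> N (rm_act x a)
    & direct_sum N (fun g => N `&` rm_hom M g)].

Definition gr_simple : Prop :=
  (exists (x : M) (a : R), rm_act x a <> 0) /\
  (forall N : set M, graded_submodule N -> N = [set 0] \/ N = setT).

Definition faithful : Prop :=
  forall a : R, (forall x : M, rm_act x a = 0) -> a = 0.

End RModProperties.

Definition right_gr_primitive (G : groupoid) (R : gradedRing G) : Prop :=
  exists M : gradedRMod R, faithful M /\ gr_simple M.

Lemma additive0 (V : zmodType) (f : V -> V) :
  (forall x y, f (x + y) = f x + f y) -> f 0 = 0.
Proof. by move=> fD; apply: (addIr (f 0)); rewrite -fD !add0r. Qed.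

Lemma additiveN (V : zmodType) (f : V -> V) x :
  (forall x y, f (x + y) = f x + f y) -> f (- x) = - f x.
Proof.
by move=> fD; apply: (addIr (f x)); rewrite -fD !addNr; exact: additive0.
Qed.

Lemma additive_sum (V : zmodType) (f : V -> V) (J : Type) (r : seq J)
    (P : pred J) (F : J -> V) :
  (forall x y, f (x + y) = f x + f y) ->
  f (\sum_(j <- r | P j) F j) = \sum_(j <- r | P j) f (F j).
Proof. by move=> fD; apply: (big_morph f fD); exact: additive0. Qed.

Lemma ffun_sumE (V : zmodType) (J : Type) (r : seq J) (P : pred J)
    (F : J -> V -> V) x :
  (\sum_(j <- r | P j) F j) x = \sum_(j <- r | P j) F j x.
Proof. by elim/big_ind2: _ => // u f v g <- <-. Qed.

Lemma independent_shift (I : Type) (V : zmodType) (H : I -> set V)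
    (W : I -> set (V -> V)) (def : I -> I -> Prop) (sh : I -> I -> I) :
  direct_sum setT H ->
  (forall g f, W g f -> forall x y, f (x + y) = f x + f y) ->
  (forall g f, W g f -> forall s x, H s x -> def g s -> H (sh g s) (f x)) ->
  (forall g f, W g f -> forall s x, H s x -> ~ def g s -> f x = 0) ->
  (forall g g' s, def g s -> def g' s -> sh g s = sh g' s -> g = g') ->
  independent W.
Proof.
move=> [hH TE iH] WD W1 W0 sh_inj n g f g_inj Wf f0 i; apply/funext => x.
have : sumset H x by rewrite -TE.
move=> [m [s [y [Hy ->]]]]; rewrite (additive_sum _ _ _ (WD _ _ (Wf i))).
apply: big1 => k _.
case: (pselect (def (g i) (s k))) => [di|]; last exact: W0 (Wf i) _ _ (Hy k).
pose h j : I := if pselect (def (g j) (s k)) then sh (g j) (s k) else s k.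
have Hh j : H (h j) (f j (y k)).
  rewrite /h; case: pselect => [dj|dj]; first exact: W1 (Wf j) _ _ (Hy k) dj.
  by rewrite (W0 _ _ (Wf j) _ _ (Hy k) dj); exact: (hH _).1.
have s0 : \sum_j f j (y k) = 0 by rewrite -ffun_sumE f0.
have := independent_filter (fun a => `[< a = sh (g i) (s k) >]) hH iH Hh s0.
rewrite (bigD1 i) /=; last by apply/asboolP; rewrite /h; case: pselect.
rewrite big1 ?addr0// => j /andP[/asboolP + ji]; rewrite /h.
case: pselect => [dj e|dj _]; last exact: W0 (Wf j) _ _ (Hy k) dj.
by move: ji; rewrite (g_inj _ _ (sh_inj _ _ _ dj di e)) eqxx.
Qed.

Lemma gcompK (G : groupoid) (g h s : G) : gdom g = gcod s -> gdom h = gcod s ->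
  gcomp g s = gcomp h s -> g = h.
Proof.
move=> e e' E; rewrite -(gcomp1 g) -(gcomp1 h) e e' -gcompV.
by rewrite !gcompA ?gcod_inv// E.
Qed.

Lemma gcompKl (G : groupoid) (g h s : G) : gdom s = gcod g -> gdom s = gcod h ->
  gcomp s g = gcomp s h -> g = h.
Proof.
move=> e e' E; rewrite -(gcomp_id g) -(gcomp_id h) -e -e' -gcompVg.
by rewrite -!gcompA ?gdom_inv// E.
Qed.

Section SumsetComp.
Variables (I : Type) (V : zmodType) (W : I -> set (V -> V)).
Hypothesis WS : forall g, is_subgroup (W g).
Hypothesis WD : forall g f, W g f -> forall x y, f (x + y) = f x + f y.
Hypothesis WM : forall g h f f', W g f -> W h f' -> sumset W (f \o f').

Lemma sumset_additive f : sumset W f -> forall x y, f (x + y) = f x + f y.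
Proof.
move=> [n [g [u [Wu ->]]]] x y; rewrite !ffun_sumE -big_split /=.
by apply: eq_bigr => i _; exact: WD (Wu i) x y.
Qed.

Lemma sumset_comp f f' : sumset W f -> sumset W f' -> sumset W (f \o f').
Proof.
move=> [n [g [u [Wu ->]]]] [m [h [v [Wv ->]]]].
have -> : (\sum_i u i) \o (\sum_j v j) = \sum_i \sum_j (u i \o v j).
  apply/funext => x; rewrite /= !ffun_sumE; apply: eq_bigr => i _.
  by rewrite !ffun_sumE (additive_sum _ _ _ (WD (Wu i))).
apply: subgroup_sum => [|i _]; first exact: sumset_subgroup.
apply: subgroup_sum => [|j _]; first exact: sumset_subgroup.
exact: WM (Wu i) (Wv j).
Qed.

End SumsetComp.

Section RightEnd.
Variables (G : groupoid) (R : gradedRing G) (M : gradedRMod R).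

Definition endr_hom (g : G) : set (M -> M) :=
  [set f | [/\ forall x y, f (x + y) = f x + f y,
               forall x a, f (rm_act x a) = rm_act (f x) a,
               forall s x, rm_hom M s x -> gdom g = gcod s ->
                 rm_hom M (gcomp g s) (f x)
             & forall s x, rm_hom M s x -> gdom g <> gcod s -> f x = 0]].

Definition endr_set : set (M -> M) := sumset endr_hom.

Lemma rm_hom_subgroup s : is_subgroup (rm_hom M s).
Proof. by case: (rm_direct M). Qed.

Lemma rm_act0 a : rm_act (0 : M) a = 0.
Proof. by apply: (addIr (rm_act 0 a)); rewrite -rm_actDl !add0r. Qed.

Lemma rm_actr0 (x : M) : rm_act x 0 = 0.
Proof. by apply: (addIr (rm_act x 0)); rewrite -rm_actDr !add0r. Qed.

Lemma rm_actB (x y : M) a : rm_act (x - y) a = rm_act x a - rm_act y a.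
Proof. by apply: (addIr (rm_act y a)); rewrite -rm_actDl !subrK. Qed.

Lemma rm_act_sum (J : Type) (r : seq J) (P : pred J) (F : J -> M) a :
  rm_act (\sum_(j <- r | P j) F j) a = \sum_(j <- r | P j) rm_act (F j) a.
Proof.
apply: (big_morph (fun x : M => rm_act x a)); last exact: rm_act0.
by move=> x y; exact: rm_actDl.
Qed.

Lemma rm_act_suml (J : Type) (r : seq J) (P : pred J) x (F : J -> R) :
  rm_act (x : M) (\sum_(j <- r | P j) F j) =
  \sum_(j <- r | P j) rm_act x (F j).
Proof.
apply: (big_morph (fun a : R => rm_act x a)); last exact: rm_actr0.
by move=> a b; exact: rm_actDr.
Qed.

Lemma endr_hom_subgroup g : is_subgroup (endr_hom g).
Proof.
split.
  split=> [x y|x a|s x _ _|//]; rewrite /= ?fctE ?addr0 ?rm_act0//.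
  exact: (rm_hom_subgroup _).1.
move=> f f' [fD fM f1 f0] [fD' fM' f1' f0']; split=> [x y|x a|s x hx e|s x hx e].
- by rewrite !fctE fD fD' opprD addrACA.
- by rewrite !fctE fM fM' rm_actB.
- rewrite !fctE; apply: (rm_hom_subgroup _).2; [exact: f1|exact: f1'].
- by rewrite !fctE (f0 s)// (f0' s)// subr0.
Qed.

Lemma endr_homD g f : endr_hom g f -> forall x y, f (x + y) = f x + f y.
Proof. by case. Qed.

Lemma endr_hom_comp g h f f' : endr_hom g f -> endr_hom h f' ->
  gdom g = gcod h -> endr_hom (gcomp g h) (f \o f').
Proof.
move=> [fD fM f1 f0] [fD' fM' f1' f0'] e.
split=> [x y|x a|s x hx|s x hx] /=.
- by rewrite fD' fD.
- by rewrite fM' fM.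
- rewrite gdom_comp// => e'; rewrite -gcompA//.
  by apply: f1; [exact: f1'|rewrite gcod_comp].
- by rewrite gdom_comp// => e'; rewrite (f0' s)//; exact: additive0.
Qed.

Lemma endr_hom_comp0 g h f f' : endr_hom g f -> endr_hom h f' ->
  gdom g <> gcod h -> f \o f' = 0.
Proof.
move=> [fD fM f1 f0] [fD' fM' f1' f0'] ne; apply/funext => x.
case: (rm_direct M) => _ TE _.
have : sumset (rm_hom M) x by rewrite -TE.
move=> [m [s [y [Hy ->]]]].
rewrite /= (additive_sum _ _ _ fD') (additive_sum _ _ _ fD).
apply: big1 => k _.
case: (pselect (gdom h = gcod (s k))) => e.
  by apply: (f0 (gcomp h (s k))); [exact: f1'|rewrite gcod_comp].
by rewrite (f0' (s k))//; exact: additive0.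
Qed.

Lemma endr_hom_comp_sumset g h f f' : endr_hom g f -> endr_hom h f' ->
  endr_set (f \o f').
Proof.
move=> hf hf'; case: (pselect (gdom g = gcod h)) => e.
  exact: sumset_sub (endr_hom_comp hf hf' e).
rewrite (endr_hom_comp0 hf hf' e).
exact: (sumset_subgroup endr_hom_subgroup).1.
Qed.

Lemma endr_direct : direct_sum endr_set endr_hom.
Proof.
split=> //; first exact: endr_hom_subgroup.
apply: (independent_shift (def := fun g s => gdom g = gcod s)
  (sh := @gcomp G) (rm_direct M)).
- exact: endr_homD.
- by move=> g f [].
- by move=> g f [].
- by move=> g g' s; exact: gcompK.
Qed.

Definition endr_sg : subgroup (M -> M) :=
  Subgroup (sumset_subgroup endr_hom_subgroup : is_subgroup endr_set).

Definition endr_comp (f f' : sg_elt endr_sg) : sg_elt endr_sg :=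
  sg_in (sumset_comp endr_hom_subgroup endr_homD endr_hom_comp_sumset
    (sg_valP f) (sg_valP f') : sg_set endr_sg _).

Fact endr_compA : associative endr_comp.
Proof. by move=> f g h; exact: sg_val_inj. Qed.

Fact endr_compDl : left_distributive endr_comp +%R.
Proof.
move=> f g h; apply: sg_val_inj.
by rewrite sg_valD -[LHS]/(sg_val (f + g) \o sg_val h) sg_valD.
Qed.

Fact endr_compDr : right_distributive endr_comp +%R.
Proof.
move=> f g h; apply: sg_val_inj.
rewrite sg_valD -[LHS]/(sg_val f \o sg_val (g + h)) sg_valD.
by apply/funext => x; exact: (sumset_additive endr_homD (sg_valP f)).
Qed.

Fact endr_gr_hom_mul g h (f f' : sg_elt endr_sg) :
  endr_hom g (sg_val f) -> endr_hom h (sg_val f') ->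
  gdom g = gcod h -> endr_hom (gcomp g h) (sg_val (endr_comp f f')).
Proof. exact: endr_hom_comp. Qed.

Fact endr_gr_hom_mul0 g h (f f' : sg_elt endr_sg) :
  endr_hom g (sg_val f) -> endr_hom h (sg_val f') ->
  gdom g <> gcod h -> endr_comp f f' = 0.
Proof.
move=> hf hf' e; apply: sg_val_inj; rewrite sg_val0.
exact: endr_hom_comp0 hf hf' e.
Qed.

Definition endr_gradedRing : gradedRing G :=
  GradedRing endr_compA endr_compDl endr_compDr (sg_direct_sum (H := endr_sg) endr_direct)
    endr_gr_hom_mul endr_gr_hom_mul0.

(* The identity of degree [e] is the projection of [M] onto the sum of the
   components whose degree has codomain [e]. *)
Lemma endr_one_exists (e : gobj G) :
  exists f : M -> M, endr_hom (gid e) f /\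
    forall s x, rm_hom M s x -> gcod s = e -> f x = x.
Proof.
case: (rm_direct M) => hM TE iM.
have hom0 s : rm_hom M s 0 by exact: (hM s).1.
pose A (s : G) : bool := `[< gcod s = e >].
have /choice[dec decP] : forall x : M, exists d : {n : nat & ('I_n -> G) * ('I_n -> M)}%type,
    (forall i, rm_hom M ((projT2 d).1 i) ((projT2 d).2 i)) /\
    x = \sum_i (projT2 d).2 i.
  move=> x; have : sumset (rm_hom M) x by rewrite -TE.
  by move=> [n [s [y [Hy E]]]]; exists (existT _ n (s, y)).
pose f x := \sum_(i | A ((projT2 (dec x)).1 i)) (projT2 (dec x)).2 i.
have fE n (s : 'I_n -> G) (y : 'I_n -> M) : (forall i, rm_hom M (s i) (y i)) ->
    f (\sum_i y i) = \sum_(i | A (s i)) y i.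
  move=> Hy; rewrite /f; set x := \sum_i y i.
  have [] := decP x; case: (dec x) => m [t z] /= Hz E.
  apply/eqP; rewrite -subr_eq0; apply/eqP.
  pose g i := match fintype.split i with inl j => t j | inr k => s k end.
  pose w i := match fintype.split i with inl j => z j | inr k => - y k end.
  have Hw i : rm_hom M (g i) (w i).
    by rewrite /g /w; case: (fintype.split i) => j//; exact: subgroupN.
  have sl (j : 'I_m) : fintype.split (lshift n j) = inl j := unsplitK (inl j).
  have sr (j : 'I_n) : fintype.split (rshift m j) = inr j := unsplitK (inr j).
  have w0 : \sum_i w i = 0.
    rewrite big_split_ord /=.
    rewrite (eq_bigr z) => [|i _]; last by rewrite /w sl.
    rewrite [X in _ + X](eq_bigr (fun k => - y k)) => [|i _]; last by rewrite /w sr.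
    by rewrite sumrN -E subrr.
  rewrite -[RHS](independent_filter A hM iM Hw w0) big_split_ord /=.
  rewrite -sumrN; congr (_ + _).
    by apply: eq_big => [i|i _]; rewrite ?/g ?/w sl.
  by apply: eq_big => [i|i _]; rewrite ?/g ?/w sr.
have f_hom s x : rm_hom M s x -> f x = if A s then x else 0.
  move=> hx; have -> : f x = f (\sum_(i < 1) x) by rewrite big_ord1.
  rewrite (fE 1%N (fun=> s))// big_mkcond big_ord1.
  by [].
have fD x y : f (x + y) = f x + f y.
  have : sumset (rm_hom M) x by rewrite -TE.
  move=> [n [s [u [Hu ->]]]].
  have : sumset (rm_hom M) y by rewrite -TE.
  move=> [m [t [v [Hv ->]]]].
  pose g i := match @fintype.split n m i with inl j => s j | inr k => t k end.
  pose w i := match @fintype.split n m i with inl j => u j | inr k => v k end.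
  have Hw i : rm_hom M (g i) (w i) by rewrite /g /w; case: (fintype.split i).
  have sl (j : 'I_n) : fintype.split (lshift m j) = inl j := unsplitK (inl j).
  have sr (j : 'I_m) : fintype.split (rshift n j) = inr j := unsplitK (inr j).
  rewrite (fE _ _ _ Hu) (fE _ _ _ Hv).
  have -> : \sum_i u i + \sum_i v i = \sum_i w i.
    rewrite big_split_ord /=; congr (_ + _); apply: eq_bigr => i _.
      by rewrite /w sl.
    by rewrite /w sr.
  rewrite (fE _ _ _ Hw) big_split_ord /=; congr (_ + _).
    by apply: eq_big => [i|i _]; rewrite ?/g ?/w sl.
  by apply: eq_big => [i|i _]; rewrite ?/g ?/w sr.
have fM x a : f (rm_act x a) = rm_act (f x) a.
  have : sumset (rm_hom M) x by rewrite -TE.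
  move=> [n [s [u [Hu ->]]]].
  have [_ RE _] := gr_direct R.
  have : sumset (gr_hom R) a by rewrite -RE.
  move=> [m [t [v [Hv ->]]]].
  rewrite rm_act_sum (additive_sum _ _ _ fD) (additive_sum _ _ _ fD) rm_act_sum.
  apply: eq_bigr => i _.
  rewrite !rm_act_suml (additive_sum _ _ _ fD); apply: eq_bigr => j _.
  rewrite (f_hom _ _ (Hu i)).
  case: (pselect (gdom (s i) = gcod (t j))) => E.
    rewrite (f_hom _ _ (rm_hom_act (Hu i) (Hv j) E)) /A gcod_comp//.
    by case: ifP => // _; rewrite rm_act0.
  rewrite (rm_hom_act0 (Hu i) (Hv j) E) additive0//.
  by case: ifP => _; rewrite ?rm_act0// (rm_hom_act0 (Hu i) (Hv j) E).
exists f; split.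
  split=> // s x hx; rewrite gdom_id (f_hom _ _ hx).
    move=> E; rewrite {1}E gcomp_id.
    by case: ifP.
  by move=> E; rewrite /A asboolF// => /esym.
by move=> s x hx E; rewrite (f_hom _ _ hx) /A asboolT.
Qed.

Definition endr_one_fun (e : gobj G) : M -> M :=
  projT1 (cid (endr_one_exists e)).

Lemma endr_one_funP e : endr_hom (gid e) (endr_one_fun e).
Proof. by rewrite /endr_one_fun; case: cid => f []. Qed.

Lemma endr_one_funE s x : rm_hom M s x -> endr_one_fun (gcod s) x = x.
Proof. by rewrite /endr_one_fun; case: cid => f [? fE] /= hx; exact: (fE s). Qed.

Definition endr_one (e : gobj G) : endr_gradedRing :=
  sg_in (sumset_sub (endr_one_funP e) : sg_set endr_sg _).

Fact endr_one_hom e : gr_hom endr_gradedRing (gid e) (endr_one e).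
Proof. exact: endr_one_funP. Qed.

Lemma eq_additive (f f' : M -> M) :
  (forall x y, f (x + y) = f x + f y) ->
  (forall x y, f' (x + y) = f' x + f' y) ->
  (forall s x, rm_hom M s x -> f x = f' x) -> f = f'.
Proof.
move=> fD fD' ff'; apply/funext => x.
case: (rm_direct M) => _ TE _.
have : sumset (rm_hom M) x by rewrite -TE.
move=> [m [s [y [Hy ->]]]].
rewrite (additive_sum _ _ _ fD) (additive_sum _ _ _ fD').
by apply: eq_bigr => k _; exact: ff' (Hy k).
Qed.

Fact endr_mul1 g (f : endr_gradedRing) : gr_hom endr_gradedRing g f ->
  gr_mul f (endr_one (gdom g)) = f.
Proof.
move=> [fD fM f1 f0]; apply: sg_val_inj.
have [oD oM o1 o0] := endr_one_funP (gdom g).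
apply: eq_additive => //= [x y|s x hx]; first by rewrite oD fD.
case: (pselect (gdom g = gcod s)) => E; first by rewrite E (endr_one_funE hx).
by rewrite (o0 s) ?gdom_id// (f0 s x)//; exact: additive0.
Qed.

Fact endr_1mul g (f : endr_gradedRing) : gr_hom endr_gradedRing g f ->
  gr_mul (endr_one (gcod g)) f = f.
Proof.
move=> [fD fM f1 f0]; apply: sg_val_inj.
have [oD oM o1 o0] := endr_one_funP (gcod g).
apply: eq_additive => //= [x y|s x hx]; first by rewrite fD oD.
case: (pselect (gdom g = gcod s)) => E.
  by have := endr_one_funE (f1 _ _ hx E); rewrite gcod_comp.
by rewrite (f0 s x)//; exact: additive0.
Qed.

(* END(M_R): endomorphisms are written on the left, and the product is the usual
   composition. *)
Definition endr : objUnitalRing G :=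
  ObjUnitalRing endr_one_hom endr_mul1 endr_1mul.

Definition endr_act (f : endr) (x : M) : M := sg_val f x.

Fact endr_actA (f f' : endr) x :
  endr_act (gr_mul f f') x = endr_act f (endr_act f' x).
Proof. by []. Qed.

Fact endr_actDl (f f' : endr) x :
  endr_act (f + f') x = endr_act f x + endr_act f' x.
Proof. by rewrite /endr_act sg_valD. Qed.

Fact endr_actDr (f : endr) x y :
  endr_act f (x + y) = endr_act f x + endr_act f y.
Proof. exact: (sumset_additive endr_homD (sg_valP f)). Qed.

Fact endr_hom_act g h (f : endr) x : gr_hom endr g f -> rm_hom M h x ->
  gdom g = gcod h -> rm_hom M (gcomp g h) (endr_act f x).
Proof. by move=> [fD fM f1 f0]; exact: f1. Qed.

Fact endr_hom_act0 g h (f : endr) x : gr_hom endr g f -> rm_hom M h x ->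
  gdom g <> gcod h -> endr_act f x = 0.
Proof. by move=> [fD fM f1 f0]; exact: f0. Qed.

Definition endr_lmod : gradedLMod endr :=
  @GradedLMod G endr M endr_act (rm_hom M) endr_actA endr_actDl endr_actDr
    (rm_direct M) endr_hom_act endr_hom_act0 endr_one_funE.

End RightEnd.

Section LeftEnd.
Variables (G : groupoid) (D : objUnitalRing G) (V : gradedLMod D).

(* Homomorphisms of a left module are written on the right: [(x)f] is [f x],
   and the product [f f'] is "first [f], then [f']". *)
Definition endl_hom (g : G) : set (V -> V) :=
  [set f | [/\ forall x y, f (x + y) = f x + f y,
               forall a x, f (lm_act a x) = lm_act a (f x),
               forall s x, lm_hom V s x -> gdom s = gcod g ->
                 lm_hom V (gcomp s g) (f x)
             & forall s x, lm_hom V s x -> gdom s <> gcod g -> f x = 0]].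

Definition endl_set : set (V -> V) := sumset endl_hom.

Lemma lm_hom_subgroup s : is_subgroup (lm_hom V s).
Proof. by case: (lm_direct V). Qed.

Lemma lm_act0 a : lm_act a (0 : V) = 0.
Proof. by apply: (addIr (lm_act a 0)); rewrite -lm_actDr !add0r. Qed.

Lemma lm_actB a (x y : V) : lm_act a (x - y) = lm_act a x - lm_act a y.
Proof. by apply: (addIr (lm_act a y)); rewrite -lm_actDr !subrK. Qed.

Lemma endl_hom_subgroup g : is_subgroup (endl_hom g).
Proof.
split.
  split=> [x y|a x|s x _ _|//]; rewrite /= ?fctE ?addr0 ?lm_act0//.
  exact: (lm_hom_subgroup _).1.
move=> f f' [fD fM f1 f0] [fD' fM' f1' f0']; split=> [x y|a x|s x hx e|s x hx e].
- by rewrite !fctE fD fD' opprD addrACA.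
- by rewrite !fctE fM fM' lm_actB.
- rewrite !fctE; apply: (lm_hom_subgroup _).2; [exact: f1|exact: f1'].
- by rewrite !fctE (f0 s)// (f0' s)// subr0.
Qed.

Lemma endl_homD g f : endl_hom g f -> forall x y, f (x + y) = f x + f y.
Proof. by case. Qed.

Lemma endl_hom_comp g h f f' : endl_hom g f -> endl_hom h f' ->
  gdom g = gcod h -> endl_hom (gcomp g h) (f' \o f).
Proof.
move=> [fD fM f1 f0] [fD' fM' f1' f0'] e.
split=> [x y|a x|s x hx|s x hx] /=.
- by rewrite fD fD'.
- by rewrite fM fM'.
- rewrite gcod_comp// => e'; rewrite gcompA//.
  by apply: f1'; [exact: f1|rewrite gdom_comp].
- by rewrite gcod_comp// => e'; rewrite (f0 s)//; exact: additive0.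
Qed.

Lemma endl_hom_comp0 g h f f' : endl_hom g f -> endl_hom h f' ->
  gdom g <> gcod h -> f' \o f = 0.
Proof.
move=> [fD fM f1 f0] [fD' fM' f1' f0'] ne; apply/funext => x.
case: (lm_direct V) => _ TE _.
have : sumset (lm_hom V) x by rewrite -TE.
move=> [m [s [y [Hy ->]]]].
rewrite /= (additive_sum _ _ _ fD) (additive_sum _ _ _ fD').
apply: big1 => k _.
case: (pselect (gdom (s k) = gcod g)) => e.
  by apply: (f0' (gcomp (s k) g)); [exact: f1|rewrite gdom_comp].
by rewrite (f0 (s k))//; exact: additive0.
Qed.

Lemma endl_hom_comp_sumset h g f' f : endl_hom h f' -> endl_hom g f ->
  endl_set (f' \o f).
Proof.
move=> hf' hf; case: (pselect (gdom g = gcod h)) => e.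
  exact: sumset_sub (endl_hom_comp hf hf' e).
rewrite (endl_hom_comp0 hf hf' e).
exact: (sumset_subgroup endl_hom_subgroup).1.
Qed.

Lemma endl_direct : direct_sum endl_set endl_hom.
Proof.
split=> //; first exact: endl_hom_subgroup.
apply: (independent_shift (def := fun g s => gdom s = gcod g)
  (sh := fun g s => gcomp s g) (lm_direct V)).
- exact: endl_homD.
- by move=> g f [].
- by move=> g f [].
- by move=> g g' s; exact: gcompKl.
Qed.

Definition endl_sg : subgroup (V -> V) :=
  Subgroup (sumset_subgroup endl_hom_subgroup : is_subgroup endl_set).

Definition endl_comp (f f' : sg_elt endl_sg) : sg_elt endl_sg :=
  sg_in (sumset_comp endl_hom_subgroup endl_homD endl_hom_comp_sumset
    (sg_valP f') (sg_valP f) : sg_set endl_sg (sg_val f' \o sg_val f)).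

Fact endl_compA : associative endl_comp.
Proof. by move=> f g h; exact: sg_val_inj. Qed.

Fact endl_compDl : left_distributive endl_comp +%R.
Proof.
move=> f g h; apply: sg_val_inj.
rewrite sg_valD -[LHS]/(sg_val h \o sg_val (f + g)) sg_valD.
by apply/funext => x; exact: (sumset_additive endl_homD (sg_valP h)).
Qed.

Fact endl_compDr : right_distributive endl_comp +%R.
Proof.
move=> f g h; apply: sg_val_inj.
by rewrite sg_valD -[LHS]/(sg_val (g + h) \o sg_val f) sg_valD.
Qed.

Fact endl_gr_hom_mul g h (f f' : sg_elt endl_sg) :
  endl_hom g (sg_val f) -> endl_hom h (sg_val f') ->
  gdom g = gcod h -> endl_hom (gcomp g h) (sg_val (endl_comp f f')).
Proof. exact: endl_hom_comp. Qed.

Fact endl_gr_hom_mul0 g h (f f' : sg_elt endl_sg) :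
  endl_hom g (sg_val f) -> endl_hom h (sg_val f') ->
  gdom g <> gcod h -> endl_comp f f' = 0.
Proof.
move=> hf hf' e; apply: sg_val_inj; rewrite sg_val0.
exact: endl_hom_comp0 hf hf' e.
Qed.

(* END(_D V) *)
Definition endl : gradedRing G :=
  GradedRing endl_compA endl_compDl endl_compDr (sg_direct_sum (H := endl_sg) endl_direct)
    endl_gr_hom_mul endl_gr_hom_mul0.

Definition endl_app (x : V) (f : endl) : V := sg_val f x.

(* The coefficients [a i] range over the left ideals D 1_{r(g i)}. *)
Definition pseudo_independent n (g : 'I_n -> G) (u : 'I_n -> V) : Prop :=
  [/\ forall i, lm_hom V (g i) (u i),
      forall i, u i <> 0
    & forall a : 'I_n -> D,
        (forall i, exists b : D, a i = gr_mul b (our_one D (gcod (g i)))) ->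
        \sum_i lm_act (a i) (u i) = 0 -> forall i, a i = 0].

Definition gr_dense (T : gradedSubring endl) : Prop :=
  forall n, (0 < n)%N -> forall (g : 'I_n -> G) (u : 'I_n -> V),
  pseudo_independent g u ->
  forall (d : 'I_n -> G) (v : 'I_n -> V),
  (forall i, lm_hom V (d i) (v i)) -> (forall i, gcod (d i) = gcod (g i)) ->
  exists t : endl, gs_set T t /\ forall i, endl_app (u i) t = v i.

End LeftEnd.

(* Main.v *)
From mathcomp Require Import all_boot all_algebra.
From mathcomp Require Import boolp classical_sets functions.
Require Import Defs.

Set Implicit Arguments.
Unset Strict Implicit.
Unset Printing Implicit Defensive.

Import GRing.Theory.
Local Open Scope classical_set_scope.
Local Open Scope ring_scope.

(** This is the Jacobson density theorem for groupoid gradings, with the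
    identity-free ring [R] acting on [S] by right multiplications.

    Every homogeneous [a] in [R] acts [D]-linearly on [S], so [R] maps to
    [END(_D S)] preserving degrees, and faithfulness makes this map injective;
    its image is a graded subring isomorphic to [R]. The content is density.

    Gr-simplicity is used in two forms. The elements killed by [R] form a
    graded submodule, hence vanish ([gr_simple_act_eq0]); and for [u]
    homogeneous and [J] a graded right ideal, [u J] is a graded submodule,
    hence is zero or [S] ([gr_simple_orbit]). So to interpolate arbitrary
    values at pseudo-independent [u_1, ..., u_n], it suffices to find, for each
    [k], an [a] that kills every [u_i] with [i <> k] but not [u_k].

    Such an [a] exists by induction on the set [A] of vectors to be killed
    ([annihilator_separates]). Suppose that everything killing the [u_i],
    [i] in [A], kills [u_k]. By induction, each [u_i] with [i] in [A] is sent
    onto all of [S] by the right ideal killing the others, so the rule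
    [u_i a |-> u_k a] on that ideal defines an endomorphism [f_i] of [S]
    ([quotient_endomorphism]). Then [u_k - sum f_i u_i] is killed by [R], so
    it is zero: this is a relation which pseudo-independence forbids.

    Homogeneity enters through the component projections: graded submodules
    and graded right ideals are recognised as the ones stable under them. They
    commute with the action because multiplication by a fixed degree in a
    groupoid is injective wherever it is defined. *)

(** * Homogeneous components *)

Section Components.
Variables (I : Type) (V : zmodType) (W : I -> set V).
Hypothesis dsW : direct_sum setT W.

Lemma homogeneous_ind (P : V -> Prop) :
  P 0 -> (forall x y, P x -> P y -> P (x + y)) ->
  (forall i x, W i x -> P x) -> forall x, P x.
Proof.
move=> P0 PD PW x; have [_ TE _] := dsW.
have : sumset W x by rewrite -TE.
by move=> [n [g [y [Wy ->]]]]; apply: big_ind => // k _; exact: PW (Wy k).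
Qed.

Lemma homogeneous_decomposition x : exists d : {n : nat & 'I_n -> I * V},
  (forall k, W (projT2 d k).1 (projT2 d k).2) /\ x = \sum_k (projT2 d k).2.
Proof.
have [_ TE _] := dsW; have : sumset W x by rewrite -TE.
by move=> [n [g [y [Wy ->]]]]; exists (existT _ n (fun k => (g k, y k))).
Qed.

Definition component (i : I) (x : V) : V :=
  let d := projT2 (projT1 (cid (homogeneous_decomposition x))) in
  \sum_(k | `[< (d k).1 = i >]) (d k).2.

Lemma homogeneous_cat n m (s : 'I_n -> I) (t : 'I_m -> I) u v :
  (forall k, W (s k) (u k)) -> (forall k, W (t k) (v k)) ->
  exists (g : 'I_(n + m) -> I) w, (forall k, W (g k) (w k)) /\
    forall A : I -> bool, \sum_(k | A (g k)) w k =
      \sum_(k | A (s k)) u k + \sum_(k | A (t k)) v k.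
Proof.
move=> Wu Wv.
exists (fun k => match fintype.split k with inl j => s j | inr j => t j end),
  (fun k => match fintype.split k with inl j => u j | inr j => v j end).
split=> [k|A]; first by case: (fintype.split k).
have sl (j : 'I_n) : fintype.split (lshift m j) = inl j := unsplitK (inl j).
have sr (j : 'I_m) : fintype.split (rshift n j) = inr j := unsplitK (inr j).
by rewrite big_split_ord /=; congr (_ + _); apply: eq_big => [j|j _];
  rewrite ?sl ?sr.
Qed.

(** Independence makes the sum of the terms of a given degree depend only on the
    total sum: subtract the two decompositions and filter. *)
Lemma component_sum i n (g : 'I_n -> I) y : (forall k, W (g k) (y k)) ->
  component i (\sum_k y k) = \sum_(k | `[< g k = i >]) y k.
Proof.
move=> Wy; have [hW _ iW] := dsW; rewrite /component.
case: cid => -[m d] /= [Wd e].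
have WNy k : W (g k) (- y k) by apply: subgroupN.
have [h [w [Ww wE]]] := homogeneous_cat Wd WNy.
have w0 : \sum_k w k = 0.
  by rewrite (wE xpredT) sumrN -e subrr.
have := independent_filter (fun j => `[< j = i >]) hW iW Ww w0.
by rewrite (wE (fun j => `[< j = i >])) sumrN => /eqP; rewrite subr_eq0 => /eqP.
Qed.

Lemma component_id i x : W i x -> component i x = x.
Proof.
move=> Wx; have -> : component i x = component i (\sum_(k < 1) x).
  by rewrite big_ord1.
rewrite (@component_sum i 1 (fun=> i))// (eq_bigl xpredT) ?big_ord1// => k.
exact: asboolT.
Qed.

Lemma component_neq i j x : W j x -> j <> i -> component i x = 0.
Proof.
move=> Wx ji; have -> : component i x = component i (\sum_(k < 1) x).
  by rewrite big_ord1.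
by rewrite (@component_sum i 1 (fun=> j))// big_pred0// => k; exact: asboolF.
Qed.

Lemma componentD i x y : component i (x + y) = component i x + component i y.
Proof.
have [_ TE _] := dsW.
have : sumset W x by rewrite -TE.
have : sumset W y by rewrite -TE.
move=> [m [t [v [Wv ->]]]] [n [s [u [Wu ->]]]].
have [g [w [Ww wE]]] := homogeneous_cat Wu Wv.
rewrite -(wE xpredT) !(component_sum i Wu, component_sum i Wv).
by rewrite (component_sum i Ww) (wE (fun j => `[< j = i >])).
Qed.

Lemma component0 i : component i 0 = 0.
Proof. exact: additive0 (componentD i). Qed.

Lemma component_hom i x : W i (component i x).
Proof.
have [hW _ _] := dsW; move: x; apply: homogeneous_ind.
- by rewrite component0; exact: (hW i).1.
- by move=> x y Wx Wy; rewrite componentD; exact: subgroupD.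
- move=> j x Wx; have [ji|ji] := pselect (j = i).
    by rewrite -ji component_id.
  by rewrite (component_neq Wx ji); exact: (hW i).1.
Qed.

(** The degrees of an arbitrary homogeneous decomposition may repeat; listing
    each of them once turns the terms into components. *)
Lemma sum_component x : exists n (g : 'I_n -> I), x = \sum_k component (g k) x.
Proof.
have [hW TE _] := dsW; have : sumset W x by rewrite -TE.
move=> [n [g [y [Wy xE]]]].
pose g' : 'I_n -> {classic I} := g.
pose s : seq {classic I} := undup [seq g' k | k <- enum 'I_n].
have gs k : g' k \in s by rewrite mem_undup map_f// mem_enum.
exists (size s), (fun k => tnth (in_tuple s) k).
rewrite -(big_tnth _ _ s xpredT (fun j => component j x)).
rewrite {1}xE (eq_bigr (fun j => \sum_(k | g' k == j) y k)); last first.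
  move=> j _; rewrite xE (component_sum j Wy); apply: eq_bigl => k.
  by apply/asboolP/eqP.
rewrite (exchange_big_dep xpredT)//=; apply: eq_bigr => k _.
rewrite big_mkcond (bigD1_seq (g' k)) ?undup_uniq//= eqxx big1 ?addr0// => j.
by rewrite eq_sym => /negbTE ->.
Qed.

(** How gradings of subgroups are obtained below: stability under the component
    maps is all that has to be checked. *)
Lemma component_closed_direct_sum (N : set V) : is_subgroup N ->
  (forall i x, N x -> N (component i x)) ->
  direct_sum N (fun i => N `&` W i).
Proof.
move=> hN NC; have [hW _ iW] := dsW.
have hNW i : is_subgroup (N `&` W i).
  split; first by split; [exact: hN.1|exact: (hW i).1].
  by move=> x y [Nx Wx] [Ny Wy]; split; [exact: hN.2|exact: (hW i).2].
split=> //.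
- apply/seteqP; split=> [x Nx|_ [n [g [x [NWx ->]]]]].
    have [n [g xE]] := sum_component x.
    exists n, g, (fun k => component (g k) x); split=> // k.
    by split; [exact: NC|exact: component_hom].
  by apply: subgroup_sum => // k _; exact: (NWx k).1.
- move=> n g x g_inj NWx; apply: iW g_inj _ => k; exact: (NWx k).2.
Qed.

End Components.

Arguments component_closed_direct_sum {I V W} dsW {N}.

(** * Graded rings and modules *)

Section GradedRing.
Variables (G : groupoid) (R : gradedRing G).

Lemma gr_0mul (b : R) : gr_mul 0 b = 0.
Proof. by apply: (addIr (gr_mul 0 b)); rewrite -gr_mulDl !add0r. Qed.

Lemma gr_mulN (a b : R) : gr_mul (- a) b = - gr_mul a b.
Proof. by apply: (addIr (gr_mul a b)); rewrite -gr_mulDl !addNr gr_0mul. Qed.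

End GradedRing.

Section LeftModule.
Variables (G : groupoid) (D : objUnitalRing G) (V : gradedLMod D).

Lemma lm_0act (x : V) : lm_act 0 x = 0.
Proof. by apply: (addIr (lm_act 0 x)); rewrite -lm_actDl !add0r. Qed.

Lemma lm_actN a (x : V) : lm_act (- a) x = - lm_act a x.
Proof. by apply: (addIr (lm_act a x)); rewrite -lm_actDl !addNr lm_0act. Qed.

End LeftModule.

Section Embedding.
Variables (G : groupoid) (R E : gradedRing G) (phi : R -> E).
Hypothesis phiD : forall x y, phi (x + y) = phi x + phi y.
Hypothesis phiM : forall x y, phi (gr_mul x y) = gr_mul (phi x) (phi y).
Hypothesis phi_hom : forall g x, gr_hom R g x -> gr_hom E g (phi x).


Let phi0 : phi 0 = 0.
Proof. by apply: (addIr (phi 0)); rewrite -phiD !add0r. Qed.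

Let phiB x y : phi (x - y) = phi x - phi y.
Proof. by apply: (addIr (phi y)); rewrite -phiD !subrK. Qed.

Lemma morphism_component g x :
  component (gr_direct E) g (phi x) = phi (component (gr_direct R) g x).
Proof.
move: x; apply: (homogeneous_ind (gr_direct R)).
- by rewrite component0 phi0 component0.
- by move=> x y hx hy; rewrite phiD !componentD hx hy phiD.
- move=> h x hx; have [hg|hg] := pselect (h = g).
    by rewrite -hg !component_id//; exact: phi_hom.
  by rewrite (component_neq _ hx hg) (component_neq _ (phi_hom hx) hg) phi0.
Qed.

Fact image_subgroup : is_subgroup (range phi).
Proof.
split; first by exists 0.
by move=> _ _ [x _ <-] [y _ <-]; exists (x - y).
Qed.

Fact image_mul x y : range phi x -> range phi y -> range phi (gr_mul x y).
Proof. by move=> [a _ <-] [b _ <-]; exists (gr_mul a b). Qed.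

Fact image_direct : direct_sum (range phi) (fun g => range phi `&` gr_hom E g).
Proof.
apply: (component_closed_direct_sum (gr_direct E) image_subgroup).
move=> g _ [x _ <-]; exists (component (gr_direct R) g x) => //.
by rewrite morphism_component.
Qed.

Definition graded_image : gradedSubring E :=
  GradedSubring image_subgroup image_mul image_direct.

Lemma gr_isomorphic_image : injective phi ->
  gr_isomorphic R (subring_gradedRing graded_image).
Proof.
move=> phi_inj.
have im x : gs_set graded_image (phi x) by exists x.
pose f x : subring_gradedRing graded_image :=
  sg_in (im x : sg_set (subring_sg graded_image) (phi x)).
have /choice[h hE] : forall y : subring_gradedRing graded_image,
    exists x, phi x = sg_val y.
  by move=> y; have [x _ <-] := sg_valP y; exists x.
exists f; split=> [x y|x y||g x hx].
- by apply: sg_val_inj; rewrite sg_valD /= phiD.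
- by apply: sg_val_inj; rewrite /= phiM.
- exists h => [x|y]; first by apply: phi_inj; rewrite hE.
  by apply: sg_val_inj; rewrite /= hE.
- by split; [exact: im|exact: phi_hom].
Qed.

End Embedding.

Section RightModule.
Variables (G : groupoid) (R : gradedRing G) (M : gradedRMod R).

Local Notation compM := (component (rm_direct M)).
Local Notation compR := (component (gr_direct R)).

Lemma rm_actrB (x : M) a b : rm_act x (a - b) = rm_act x a - rm_act x b.
Proof. by apply: (addIr (rm_act x b)); rewrite -rm_actDr !subrK. Qed.

(** The components of [x] contribute to distinct components of [x a], since
    [gcomp g h] determines [g] once [h] is fixed. *)
Lemma component_actl g h (x : M) a : gr_hom R h a -> gdom g = gcod h ->
  compM (gcomp g h) (rm_act x a) = rm_act (compM g x) a.
Proof.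
move=> ha gh; move: x; apply: (homogeneous_ind (rm_direct M)).
- by rewrite !(rm_act0, component0).
- by move=> x y ex ey; rewrite rm_actDl !componentD ex ey rm_actDl.
move=> s x hx; have [sg|sg] := pselect (s = g).
  rewrite -sg (component_id _ hx) component_id//.
  by apply: rm_hom_act => //; rewrite sg.
rewrite (component_neq _ hx sg) rm_act0.
have [sh|sh] := pselect (gdom s = gcod h); last first.
  by rewrite (rm_hom_act0 hx ha sh) component0.
apply: (component_neq _ (rm_hom_act hx ha sh)) => e.
exact: sg (gcompK sh gh e).
Qed.

Lemma component_actr g h (x : M) a : rm_hom M g x -> gdom g = gcod h ->
  compM (gcomp g h) (rm_act x a) = rm_act x (compR h a).
Proof.
move=> hx gh; move: a; apply: (homogeneous_ind (gr_direct R)).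
- by rewrite component0 !rm_actr0 component0.
- by move=> a b ea eb; rewrite rm_actDr !componentD ea eb rm_actDr.
move=> s a ha; have [sh|sh] := pselect (s = h).
  rewrite -sh (component_id _ ha) component_id//.
  by apply: rm_hom_act => //; rewrite sh.
rewrite (component_neq _ ha sh) rm_actr0.
have [gs|gs] := pselect (gdom g = gcod s); last first.
  by rewrite (rm_hom_act0 hx ha gs) component0.
apply: (component_neq _ (rm_hom_act hx ha gs)) => e.
exact: sh (gcompKl gs gh e).
Qed.

(** Acting on the right does not change the codomain of a degree, so the orbit of
    a homogeneous element lives over a single object. *)
Lemma component_act_cod g s (x : M) a : rm_hom M g x -> gcod s <> gcod g ->
  compM s (rm_act x a) = 0.
Proof.
move=> hx sg; move: a; apply: (homogeneous_ind (gr_direct R)).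
- by rewrite rm_actr0 component0.
- by move=> a b ea eb; rewrite rm_actDr componentD ea eb addr0.
move=> h a ha; have [gh|gh] := pselect (gdom g = gcod h); last first.
  by rewrite (rm_hom_act0 hx ha gh) component0.
apply: (component_neq _ (rm_hom_act hx ha gh)) => e.
by apply: sg; rewrite -e gcod_comp.
Qed.

(** Every degree with the codomain of [g] is [g] times a unique degree. *)
Lemma gcomp_divl (g s : G) : gcod s = gcod g ->
  gdom g = gcod (gcomp (ginv g) s) /\ gcomp g (gcomp (ginv g) s) = s.
Proof.
move=> sg; have e : gdom (ginv g) = gcod s by rewrite gdom_inv sg.
by rewrite gcod_comp// gcod_inv gcompA ?gcod_inv// gcompV -sg gcomp_id.
Qed.

Definition graded_right_ideal (J : set R) : Prop :=
  [/\ is_subgroup J, forall a b, J a -> J (gr_mul a b)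
    & forall h a, J a -> J (compR h a)].

(** The component of [x a] of degree [s] is [x] times the component of [a] of
    degree [g^-1 s], when [s] and [g] have the same codomain, and is zero
    otherwise. *)
Lemma orbit_submodule g (x : M) J : rm_hom M g x -> graded_right_ideal J ->
  graded_submodule [set rm_act x a | a in J].
Proof.
move=> hx [hJ JM JC].
have hN : is_subgroup [set rm_act x a | a in J].
  split; first by exists 0; [exact: hJ.1|exact: rm_actr0].
  move=> _ _ [a Ja <-] [b Jb <-]; exists (a - b); last exact: rm_actrB.
  exact: hJ.2.
split=> //.
  by move=> _ b [a Ja <-]; exists (gr_mul a b); [exact: JM|exact: rm_actA].
apply: (component_closed_direct_sum (rm_direct M) hN) => s _ [a Ja <-].
have [sg|sg] := pselect (gcod s = gcod g); last first.
  by rewrite (component_act_cod _ hx sg); exact: hN.1.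
have [e1 e2] := gcomp_divl sg.
exists (compR (gcomp (ginv g) s) a); first exact: JC.
by rewrite -{2}e2 component_actr.
Qed.

Lemma annihilator_right_ideal n (A : {set 'I_n}) (g : 'I_n -> G)
    (u : 'I_n -> M) : (forall i, rm_hom M (g i) (u i)) ->
  graded_right_ideal [set a | forall i, i \in A -> rm_act (u i) a = 0].
Proof.
move=> hu; split.
- split=> [i _|a b Ja Jb i iA]; first exact: rm_actr0.
  by rewrite rm_actrB Ja// Jb// subr0.
- by move=> a b Ja i iA; rewrite rm_actA Ja// rm_act0.
- move=> h a Ja i iA; have [gh|gh] := pselect (gdom (g i) = gcod h).
    by rewrite -(component_actr _ (hu i) gh) Ja// component0.
  exact: rm_hom_act0 (hu i) (component_hom _ _ _) gh.
Qed.

(** A homogeneous [a] that kills [x] kills the components of [x] one at a time,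
    as their images under [a] have distinct degrees. *)
Lemma null_submodule : graded_submodule [set x : M | forall a, rm_act x a = 0].
Proof.
have hN : is_subgroup [set x : M | forall a, rm_act x a = 0].
  split=> [a|x y Nx Ny a]; first exact: rm_act0.
  by rewrite rm_actB Nx Ny subr0.
split=> //; first by move=> x a Nx b; rewrite Nx rm_act0.
apply: (component_closed_direct_sum (rm_direct M) hN) => g x Nx.
apply: (homogeneous_ind (gr_direct R)).
- exact: rm_actr0.
- by move=> a b ea eb; rewrite rm_actDr ea eb addr0.
move=> h a ha; have [gh|gh] := pselect (gdom g = gcod h).
  by rewrite -(component_actl _ ha gh) Nx component0.
exact: rm_hom_act0 (component_hom _ _ _) ha gh.
Qed.

End RightModule.

(** * Density *)

Section GrSimple.
Variables (G : groupoid) (R : gradedRing G) (S : gradedRMod R).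
Hypothesis S_simple : gr_simple S.

Local Notation D := (endr S).
Local Notation V := (endr_lmod S).
Local Notation compR := (component (gr_direct R)).

Lemma gr_simple_act_eq0 (x : S) : (forall a, rm_act x a = 0) -> x = 0.
Proof.
have [[y [b yb]] Ssub] := S_simple => x0.
have [N0|NT] := Ssub _ (null_submodule S).
  have : [set x : S | forall a, rm_act x a = 0] x by [].
  by rewrite N0.
have : [set x : S | forall a, rm_act x a = 0] y by rewrite NT.
by move=> /(_ b).
Qed.

Lemma gr_simple_orbit g (u : S) J : rm_hom S g u -> graded_right_ideal J ->
  (exists2 a, J a & rm_act u a <> 0) ->
  forall x, exists2 a, J a & rm_act u a = x.
Proof.
move=> hu hJ [a Ja ua] x.
have [N0|NT] := S_simple.2 _ (orbit_submodule hu hJ).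
  have : [set rm_act u b | b in J] (rm_act u a) by exists a.
  by rewrite N0.
have : [set rm_act u b | b in J] x by rewrite NT.
by move=> [b Jb <-]; exists b.
Qed.

Lemma endr_commutes (f : D) (x : S) a :
  lm_act f (rm_act x a : V) = rm_act (lm_act f (x : V) : S) a.
Proof.
have [n [g [h [hh fE]]]] := sg_valP f.
rewrite /= /endr_act fE !ffun_sumE rm_act_sum; apply: eq_bigr => i _.
by have [_ + _ _] := hh i; apply.
Qed.

(** The rule [u a |-> w a], [a] in [J], is a homomorphism on [u J = S]; its degree
    is [t g^-1], which makes sense only if [t] and [g] have the same domain.
    Otherwise no homogeneous [a] acts nontrivially on both [u] and [w], which
    forces [w J = 0]. *)
Lemma quotient_endomorphism g t (u w : S) J :
  rm_hom S g u -> rm_hom S t w -> graded_right_ideal J ->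
  (forall x, exists2 a, J a & rm_act u a = x) ->
  (forall a, J a -> rm_act u a = 0 -> rm_act w a = 0) ->
  exists f : D, (exists b : D, f = gr_mul b (our_one D (gcod g))) /\
    forall a, J a -> lm_act f (rm_act u a : V) = rm_act w a.
Proof.
move=> hu hw [hJ JM JC] uJ uw.
have [tg|tg] := pselect (gdom t = gdom g); last first.
  exists 0; split; first by exists 0; rewrite gr_0mul.
  move=> a Ja; apply: (etrans (lm_0act (rm_act u a : V))); apply: esym.
  have [n [h aE]] := sum_component (gr_direct R) a.
  rewrite aE rm_act_suml big1// => k _.
  have ch := component_hom (gr_direct R) (h k) a.
  have [th|th] := pselect (gdom t = gcod (h k)); last exact: rm_hom_act0 hw ch th.
  apply: uw; first exact: JC.
  by apply: (rm_hom_act0 hu ch) => gh; apply: tg; rewrite gh.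
have /choice[f fP] : forall x, exists y, forall a, J a -> rm_act u a = x ->
    rm_act w a = y.
  move=> x; have [a Ja ua] := uJ x; exists (rm_act w a) => b Jb ub.
  apply/eqP; rewrite -subr_eq0 -rm_actrB; apply/eqP; apply: uw.
    exact: hJ.2.
  by rewrite rm_actrB ua ub subrr.
have fE a : J a -> f (rm_act u a) = rm_act w a.
  by move=> Ja; rewrite -(fP _ _ Ja erefl).
have eg : gdom t = gcod (ginv g) by rewrite gcod_inv.
(* A preimage of a homogeneous element may be cut down to the one component of
   [a] that contributes to it. *)
have lift s x : rm_hom S s x -> exists2 a, J a & rm_act u a = x /\
    (gcod s = gcod g -> gr_hom R (gcomp (ginv g) s) a).
  move=> hx; have [a Ja ua] := uJ x.
  have [sg|sg] := pselect (gcod s = gcod g); last by exists a.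
  have [e1 e2] := gcomp_divl sg.
  exists (compR (gcomp (ginv g) s) a); first exact: JC.
  split; last by move=> _; exact: component_hom.
  by rewrite -(component_actr _ hu e1) e2 ua component_id.
have f_hom : endr_hom (gcomp t (ginv g)) f.
  split.
  - move=> x y; have [a Ja <-] := uJ x; have [b Jb <-] := uJ y.
    rewrite -rm_actDr !fE//; first exact: rm_actDr.
    exact: subgroupD.
  - move=> x b; have [a Ja <-] := uJ x.
    by rewrite -rm_actA !fE ?rm_actA//; exact: JM.
  - move=> s x hx; rewrite gdom_comp// gdom_inv => /esym sg.
    have [a Ja [<- /(_ sg) ha]] := lift s x hx; rewrite fE//.
    have [e1 _] := gcomp_divl sg.
    rewrite -gcompA ?gdom_inv//; apply: rm_hom_act => //.
    by rewrite tg e1.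
  - move=> s x hx; rewrite gdom_comp// gdom_inv => sg.
    (* then [S_s = 0], since [S = u R] lives over the codomain of [g] *)
    have x0 : x = 0.
      have [a _ ua] := uJ x; rewrite -(component_id (rm_direct S) hx) -ua.
      by apply: (component_act_cod _ hu) => e; apply: sg.
    have -> : x = rm_act u 0 by rewrite rm_actr0.
    by rewrite fE ?rm_actr0//; exact: hJ.1.
pose F : D := sg_in (sumset_sub f_hom : sg_set (endr_sg S) f).
exists F; split; last exact: fE.
(* [f] has degree [t g^-1], whose domain is the codomain of [g], so [1_{r(g)}]
   is a right identity for it. *)
exists F; have hF : gr_hom D (gcomp t (ginv g)) F by [].
by have := our_mul1 hF; rewrite gdom_comp// gdom_inv => ->.
Qed.

Section Interpolation.
Variables (n : nat) (g : 'I_n -> G) (u : 'I_n -> S).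
Hypothesis u_indep : @pseudo_independent G D V n g u.

Let hu i : rm_hom S (g i) (u i).
Proof. by have [+ _ _] := u_indep; apply. Qed.

Local Notation ann A := [set a : R | forall i, i \in A -> rm_act (u i) a = 0].

(** The induction is on the number of vectors to kill: inside the step, the
    induction hypothesis makes the ideal killing [A :\ i] carry [u i] onto [S],
    which is what defines the endomorphisms [f i] of the forbidden relation. *)
Lemma annihilator_separates (A : {set 'I_n}) k : k \notin A ->
  exists2 a, ann A a & rm_act (u k) a <> 0.
Proof.
have [m] := ubnP #|A|; elim: m A k => // m IHm A k Am kA.
have [//|uk0'] := pselect (exists2 a, ann A a & rm_act (u k) a <> 0).
have uk0 a : ann A a -> rm_act (u k) a = 0.
  by move=> Aa; apply: contrapT => uka; apply: uk0'; exists a.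
have orbit i : i \in A -> forall x, exists2 a, ann (A :\ i) a &
    rm_act (u i) a = x.
  move=> iA; apply: (gr_simple_orbit (hu i)).
    exact: annihilator_right_ideal hu.
  apply: IHm; last by rewrite !inE eqxx.
  by move: Am; rewrite (cardsD1 i A) iA.
have annD1 i a : ann (A :\ i) a -> rm_act (u i) a = 0 -> ann A a.
  move=> Aa ia j jA; have [->//|ji] := eqVneq j i.
  by apply: Aa; rewrite !inE ji.
have /choice[f fP] : forall i, exists f : D, i \in A ->
    (exists b : D, f = gr_mul b (our_one D (gcod (g i)))) /\
    forall a, ann (A :\ i) a -> lm_act f (rm_act (u i) a : V) = rm_act (u k) a.
  move=> i; have [iA|_] := boolP (i \in A); last by exists 0.
  have [|f [f1 f2]] := quotient_endomorphism (hu i) (hu k)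
    (annihilator_right_ideal (A :\ i) hu) (orbit i iA).
    by move=> a Aa ia; apply: uk0; exact: annD1 ia.
  by exists f.
(* Correct [a] by elements [c i] that act like [a] on [u i] and kill the other
   vectors of [A]: the difference kills all of [A], hence also [u k]. *)
have rel a : rm_act (u k) a = \sum_(i in A) lm_act (f i) (rm_act (u i) a : V).
  have /choice[c cP] : forall i, exists c, i \in A ->
      ann (A :\ i) c /\ rm_act (u i) c = rm_act (u i) a.
    move=> i; have [iA|_] := boolP (i \in A); last by exists 0.
    by have [c Ac uc] := orbit i iA (rm_act (u i) a); exists c.
  have : rm_act (u k) (a - \sum_(i in A) c i) = 0.
    apply: uk0 => j jA; rewrite rm_actrB rm_act_suml (bigD1 j)//=.
    rewrite (cP j jA).2 big1 ?addr0 ?subrr// => i /andP[iA ij].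
    by apply: (cP i iA).1; rewrite !inE eq_sym ij.
  rewrite rm_actrB rm_act_suml => /eqP; rewrite subr_eq0 => /eqP ->.
  apply: eq_bigr => i iA; have [Ac <-] := cP i iA.
  by rewrite (fP i iA).2.
pose one i : D := our_one D (gcod (g i)).
have oneM i : gr_mul (one i) (one i) = one i.
  by have := our_mul1 (our_one_hom D (gcod (g i))); rewrite gdom_id.
have one_u i : lm_act (one i) (u i : V) = u i := lm_act1 (hu i : lm_hom V _ _).
(* the coefficients of the forbidden relation [sum f_i u_i - u_k = 0] *)
pose c i : D := if i \in A then f i else if i == k then - one k else 0.
have [_ unz u_free] := u_indep.
suff ck : c k = 0.
  move: ck; rewrite /c (negbTE kA) eqxx => /eqP; rewrite oppr_eq0 => /eqP one0.
  by case: (unz k); rewrite -(one_u k) one0 lm_0act.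
apply: u_free => [i|].
- rewrite /c; case: ifP => [iA|_]; first exact: (fP i iA).1.
  case: eqP => [->|_]; last by exists 0; rewrite gr_0mul.
  by exists (- one k); rewrite gr_mulN oneM.
- have -> : \sum_i lm_act (c i) (u i : V) =
      \sum_(i in A) lm_act (f i) (u i : V) - u k.
    rewrite (bigID (mem A)) /=; congr (_ + _).
      by apply: eq_bigr => i iA; rewrite /c iA.
    rewrite (bigD1 k)//= big1 ?addr0.
      rewrite /c (negbTE kA) eqxx.
      exact: etrans (lm_actN _ _) (congr1 -%R (one_u k)).
    move=> i /andP[/negbTE iA /negbTE ik]; rewrite /c iA ik.
    exact: (lm_0act (u i : V)).
  apply: gr_simple_act_eq0 => a; rewrite rm_actB rm_act_sum rel.
  by rewrite -sumrB big1// => i _; rewrite endr_commutes subrr.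
Qed.

Lemma interpolation (v : 'I_n -> S) : exists a, forall i, rm_act (u i) a = v i.
Proof.
have /choice[c cP] : forall i, exists a, ann [set~ i]%SET a /\ rm_act (u i) a = v i.
  move=> i; have [a Aa ua] : exists2 a, ann [set~ i]%SET a & rm_act (u i) a = v i.
    apply: (gr_simple_orbit (hu i)).
      exact: annihilator_right_ideal hu.
    by apply: annihilator_separates; rewrite !inE eqxx.
  by exists a.
exists (\sum_i c i) => i; rewrite rm_act_suml (bigD1 i)//= (cP i).2.
rewrite big1 ?addr0// => j ji; apply: (cP j).1.
by rewrite !inE eq_sym.
Qed.

End Interpolation.
End GrSimple.

(** * Right multiplications *)

Section RightMultiplication.
Variables (G : groupoid) (R : gradedRing G) (S : gradedRMod R).

Local Notation V := (endr_lmod S).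

Lemma right_mul_hom h a : gr_hom R h a ->
  endl_hom (V := V) h (fun x => rm_act (x : S) a).
Proof.
move=> ha; split=> [x y|f x|s x hx sh|s x hx sh].
- exact: rm_actDl.
- by rewrite endr_commutes.
- exact: rm_hom_act.
- exact: rm_hom_act0 hx ha sh.
Qed.

Lemma right_mul_endl a : endl_set (V := V) (fun x => rm_act (x : S) a).
Proof.
move: a; apply: (homogeneous_ind (gr_direct R)).
- have -> : (fun x : V => rm_act (x : S) 0) = 0.
    by apply/funext => x; exact: rm_actr0.
  exact: (sumset_subgroup (@endl_hom_subgroup _ _ V)).1.
- move=> a b ha hb.
  have -> : (fun x : V => rm_act (x : S) (a + b)) =
      (fun x : V => rm_act (x : S) a) + (fun x : V => rm_act (x : S) b).
    by apply/funext => x; exact: rm_actDr.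
  exact: (subgroupD (sumset_subgroup (@endl_hom_subgroup _ _ V))).
- by move=> h a ha; apply: sumset_sub; exact: right_mul_hom ha.
Qed.

Definition right_mul (a : R) : endl V :=
  sg_in (right_mul_endl a : sg_set (endl_sg V) _).

Fact right_mulD a b : right_mul (a + b) = right_mul a + right_mul b.
Proof.
by apply: sg_val_inj; rewrite sg_valD; apply/funext => x; exact: rm_actDr.
Qed.

Fact right_mulM a b : right_mul (gr_mul a b) = gr_mul (right_mul a) (right_mul b).
Proof. by apply: sg_val_inj; apply/funext => x; exact: rm_actA. Qed.

Fact right_mul_gr_hom h a : gr_hom R h a -> gr_hom (endl V) h (right_mul a).
Proof. exact: right_mul_hom. Qed.

Lemma right_mul_inj : faithful S -> injective right_mul.
Proof.
move=> Sf a b /(congr1 (@sg_val _ (endl_sg V))) ab.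
apply/eqP; rewrite -subr_eq0; apply/eqP; apply: Sf => x.
rewrite rm_actrB; apply/eqP; rewrite subr_eq0; apply/eqP.
exact: (congr1 (fun f : V -> V => f x) ab).
Qed.

End RightMultiplication.

Theorem theorem6p3 (G : groupoid) (R : gradedRing G)
  (hR : right_gr_primitive R)
  (S : gradedRMod R) (hfaithful : faithful S) (hsimple : gr_simple S) :
  let D : objUnitalRing G := endr S in
  let V : gradedLMod D := endr_lmod S in
  exists T : gradedSubring (endl V),
    gr_dense T /\ gr_isomorphic R (subring_gradedRing T).
Proof.
move=> D V.
exists (graded_image (@right_mulD _ _ S) (@right_mulM _ _ S)
  (@right_mul_gr_hom _ _ S)); split.
  move=> n _ g u u_indep d v _ _.
  have [a uv] := interpolation hsimple u_indep v.
  by exists (right_mul S a); split; first exists a.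
exact/gr_isomorphic_image/right_mul_inj.
Qed.
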